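(* Let $P:\mathscr X\to\mathscr Y$ be continuously differentiable, let $\Lambda$ be the union of finitely many convex polyhedral sets in $\mathscr Y$, let $\bar x\in\mathscr X$ with $P(\bar x)\in\Lambda$, and suppose that $\nabla P$ is directionally calm at $\bar x$ in each direction $u\neq0$ such that $\nabla P(\bar x)u\in T_\Lambda(P(\bar x))$. Suppose that the second-order sufficient condition for metric subregularity (SOSCMS) holds at $\bar x$, i.e., for all $u\neq0$ such that $\nabla P(\bar x)u\in T_\Lambda(P(\bar x))$ there exists no $\zeta\neq0$ such that $$\nabla P(\bar x)^*\zeta=0,\qquad \zeta\in N_\Lambda(P(\bar x);\nabla P(\bar x)u),\qquad \exists\, l\in D^2P(\bar x)(u)\ \text{ with }\ \langle\zeta,l\rangle\ge0.$$ Then directional pseudo-normality holds at $\bar x$.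
   Context: $\mathscr X,\mathscr Y$ are finite-dimensional Hilbert spaces; $t_k\downarrow0$ means $t_k>0$ and $t_k\to0$. A convex polyhedral set is a set of the form $\{y\in\mathscr Y:\langle\lambda_j,y\rangle\le b_j,\ j=1,\dots,q\}$. For a set $\Omega$ and $\bar y\in\Omega$: $T_\Omega(\bar y)=\{d:\exists t_k\downarrow0,\ d_k\to d \text{ with } \bar y+t_kd_k\in\Omega\ \forall k\}$; $\widehat N_\Omega(\bar y)=\{\zeta:\limsup_{y\to\bar y,\,y\in\Omega}\langle\zeta,y-\bar y\rangle/\|y-\bar y\|\le0\}$ (empty at points outside $\Omega$); $N_\Omega(\bar y;d)=\{\zeta:\exists t_k\downarrow0,\ d_k\to d,\ \zeta_k\to\zeta \text{ with } \zeta_k\in\widehat N_\Omega(\bar y+t_kd_k)\ \forall k\}$. $\nabla P$ is directionally calm at $\bar x$ in direction $u$ if there exist positive numbers $\epsilon,\delta,L_u$ such that $\|\nabla P(\bar x+tu')-\nabla P(\bar x)\|\le L_u\|tu'\|$ for all $0<t<\epsilon$ and $\|u'-u\|<\delta$. Second-order graphical derivative: $D^2P(\bar x)(u)=\Big\{l\in\mathscr Y:\exists t_k\downarrow0,\ u^k\to u \text{ with } l=\lim_{k\to\infty}\frac{P(\bar x+t_ku^k)-P(\bar x)-t_k\nabla P(\bar x)u^k}{\frac12t_k^2}\Big\}$. Directional pseudo-normality (for continuously differentiable $P$) holds at $\bar x$ if for all $u\neq0$ with $\nabla P(\bar x)u\in T_\Lambda(P(\bar x))$ there exists no $\zeta\neq0$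 such that $\nabla P(\bar x)^*\zeta=0$, $\zeta\in N_\Lambda(P(\bar x);\nabla P(\bar x)u)$, and there exist $(u^k,s^k,\zeta^k)\to(u,P(\bar x),\zeta)$ and $t_k\downarrow0$ such that for all $k$, $\zeta^k\in\widehat N_\Lambda(s^k)$ and $\langle\zeta,P(\bar x+t_ku^k)-s^k\rangle>0$. *)

(* Defs.v *)
From HB Require Import structures.
From mathcomp Require Import all_boot all_order all_algebra sesquilinear.
From mathcomp Require Import all_classical all_reals all_analysis.

Set Implicit Arguments.
Unset Strict Implicit.
Unset Printing Implicit Defensive.

Import Order.TTheory GRing.Theory Num.Theory numFieldNormedType.Exports.

Local Open Scope classical_set_scope.
Local Open Scope ring_scope.

(* Finite-dimensional real Hilbert spaces: the dimension is finite by vectType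
   (so completeness is automatic), and the norm, hence the topology, is the one
   induced by the inner product. *)
HB.mixin Record NormedModule_isFdHilbert (R : realType) V
    & Vector R V & NormedModule R V := {
  inner : {dot V for idfun} ;
  inner_norm : forall x : V, inner x x = `|x| ^+ 2
}.

#[short(type="fdHilbertType")]
HB.structure Definition FdHilbert (R : realType) :=
  {V of Vector R V & NormedModule R V & NormedModule_isFdHilbert R V}.

Section Inner.
Context {R : realType} {X : fdHilbertType R}.
Implicit Types x y : X.

Lemma inner_eq0 x : (inner x x == 0) = (x == 0).
Proof. by rewrite inner_norm sqrf_eq0 normr_eq0. Qed.

Lemma riesz (phi : {linear X -> R}) : exists x, forall u, inner x u = phi u.
Proof.
pose n := \dim {:X}; pose b := vbasis {:X}.
pose h x : 'rV[R]_n := \row_i inner x b`_i.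
have hlin : linear h.
  by move=> a x y; apply/rowP => i; rewrite !mxE linearPl.
pose hM := GRing.isLinear.Build R X 'rV[R]_n _ h hlin.
pose H : {linear X -> 'rV[R]_n} := HB.pack h hM.
have ext x (psi : {linear X -> R}) :
    (forall i : 'I_n, inner x b`_i = psi b`_i) -> forall u, inner x u = psi u.
  move=> bE u; rewrite (coord_vbasis (memvf u)) !linear_sum /=.
  by apply: eq_bigr => i _; rewrite linearZr linearZ /= bE.
have Hker : (lker (linfun H) == 0)%VS.
  apply/lker0P => x y; rewrite !lfunE /= => /rowP hxy.
  apply/eqP; rewrite -subr_eq0 -inner_eq0.
  apply/eqP; apply: (ext (x - y) (\0 : {linear X -> R})) => i.
  by have := hxy i; rewrite !mxE linearBl /= => ->; rewrite subrr.
have Hfull : (limg (linfun H) == fullv)%VS.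
  by rewrite eqEdim subvf /= (limg_dim_eq (_ : _ :&: _ = 0)%VS)
    ?(eqP Hker) ?capv0 // dimvf /dim /= mul1n.
have /memv_imgP[x _ xE] : \row_(i < n) phi b`_i \in limg (linfun H).
  by rewrite (eqP Hfull) memvf.
exists x; apply: ext => i; move/rowP/(_ i): xE.
by rewrite lfunE /= !mxE.
Qed.

End Inner.

Section Adjoint.
Context {R : realType} {X Y : fdHilbertType R}.

Definition adjoint (A : X -> Y) (z : Y) : X :=
  get [set x : X | forall u, inner x u = inner z (A u)].

Lemma adjointP (A : {linear X -> Y}) z u :
  inner (adjoint A z) u = inner z (A u).
Proof.
have lin : linear (fun u => inner z (A u) : R^o).
  by move=> a x y; rewrite linearP linearPr.
pose M := GRing.isLinear.Build R X R^o _ _ lin.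
have [x xE] := riesz (HB.pack (fun u => inner z (A u)) M).
by have /(_ u) := getPex (ex_intro [set x | forall u, inner x u = _] x xE).
Qed.

Definition opnorm (A : X -> Y) : R :=
  sup [set `|A v| | v in [set v : X | `|v| <= 1]].

End Adjoint.

Definition positive_null (R : realType) (t : R^nat) : Prop :=
  (forall k, 0 < t k) /\ t @ \oo --> (0 : R).

Section VariationalGeometry.
Context {R : realType} {Y : fdHilbertType R}.
Implicit Types (Omega : set Y) (y d zeta : Y).

Definition convex_polyhedral (Q : set Y) : Prop :=
  exists (q : nat) (lambda : 'I_q -> Y) (b : 'I_q -> R),
    Q = [set y | forall j, inner (lambda j) y <= b j].

Definition finite_union_of_polyhedral (Lambda : set Y) : Prop :=
  exists (p : nat) (Q : 'I_p -> set Y),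
    (forall i, convex_polyhedral (Q i)) /\
    Lambda = \bigcup_(i in [set: 'I_p]) Q i.

Definition tangent_cone Omega y : set Y := [set d |
  exists (t : R^nat) (dk : nat -> Y),
    [/\ positive_null t, dk @ \oo --> d &
        forall k, Omega (y + t k *: dk k)]].

(* At an isolated point of Omega the filter below is not proper, the limsup is
   -oo, and every zeta is regular normal. *)
Definition regular_normal_cone Omega y : set Y := [set zeta |
  Omega y /\
  (limf_esup (fun y' => (inner zeta (y' - y) / `|y' - y|)%:E)
     (within Omega y^') <= 0)%E].

Definition directional_normal_cone Omega y d : set Y := [set zeta |
  exists (t : R^nat) (dk zetak : nat -> Y),
    [/\ positive_null t, dk @ \oo --> d, zetak @ \oo --> zeta &
        forall k, regular_normal_cone Omega (y + t k *: dk k) (zetak k)]].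

End VariationalGeometry.

Section ConstraintSystem.
Context {R : realType} {X Y : fdHilbertType R}.
Variables (P : X -> Y) (Lambda : set Y).
Implicit Types (x u : X) (zeta l : Y).

Definition continuously_differentiable : Prop :=
  (forall x, differentiable P x) /\
  (forall x, opnorm ('d P y \- 'd P x) @[y --> x] --> (0 : R)).

Definition directionally_calm_gradient x u : Prop :=
  exists (epsilon delta L : R),
    [/\ 0 < epsilon, 0 < delta, 0 < L &
        forall (t : R) (u' : X), 0 < t -> t < epsilon -> `|u' - u| < delta ->
          opnorm ('d P (x + t *: u') \- 'd P x) <= L * `|t *: u'|].

Definition second_graphical_derivative x u : set Y := [set l |
  exists (t : R^nat) (uk : nat -> X),
    [/\ positive_null t, uk @ \oo --> u &
        (2^-1 * t k ^+ 2)^-1 *: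
          (P (x + t k *: uk k) - P x - t k *: 'd P x (uk k))
          @[k --> \oo] --> l]].

Definition critical_direction x u : Prop :=
  u != 0 /\ tangent_cone Lambda (P x) ('d P x u).

Definition SOSCMS x : Prop :=
  forall u, critical_direction x u ->
    ~ exists zeta, [/\ zeta != 0, adjoint ('d P x) zeta = 0,
        directional_normal_cone Lambda (P x) ('d P x u) zeta &
        exists l, second_graphical_derivative x u l /\ 0 <= inner zeta l].

Definition directional_pseudo_normality x : Prop :=
  forall u, critical_direction x u ->
    ~ exists zeta, [/\ zeta != 0, adjoint ('d P x) zeta = 0,
        directional_normal_cone Lambda (P x) ('d P x u) zeta &
        exists (uk : nat -> X) (sk zetak : nat -> Y) (t : R^nat),
          [/\ uk @ \oo --> u, sk @ \oo --> P x, zetak @ \oo --> zeta,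
              positive_null t &
              forall k, regular_normal_cone Lambda (sk k) (zetak k) /\
                0 < inner zeta (P (x + t k *: uk k) - sk k)]].

End ConstraintSystem.

(* Main.v *)
Require Import Defs.
From mathcomp Require Import all_boot all_order all_algebra sesquilinear.
From mathcomp Require Import all_classical all_reals all_analysis.
From mathcomp Require Import ring lra.

(** Suppose a multiplier [zeta] and sequences [t k], [uk k], [sk k], [zetak k]
    violate directional pseudo-normality in direction [u].  On a convex
    polyhedron the regular normal cone at a point depends only on the active
    constraints, so along a subsequence the normals of [Lambda] at [sk k] all
    lie in one fixed closed cone; hence [zeta] lies there too and
    [<zeta, sk k - P xbar> >= 0].  Together with
    [<zeta, P (xbar + t k * uk k) - sk k> > 0] and the adjoint condition, [zeta]
    is nonnegative on the second-order difference quotients of [P].  By the mean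
    value theorem and directional calmness these quotients are bounded, and any
    cluster point [l] of them contradicts SOSCMS. *)

Set Implicit Arguments.
Unset Strict Implicit.
Unset Printing Implicit Defensive.

Import Order.TTheory GRing.Theory Num.Theory numFieldNormedType.Exports.

Local Open Scope classical_set_scope.
Local Open Scope ring_scope.

(** * Cauchy-Schwarz and continuity of the inner product *)

Section Inner.
Context {R : realType} {Y : fdHilbertType R}.
Implicit Types x y z : Y.

Lemma innerC x y : inner x y = inner y x.
Proof. by rewrite hermC expr0 mul1r. Qed.

Lemma inner_le x y : inner x y <= `|x| * `|y|.
Proof.
have [->|x0] := eqVneq x 0; first by rewrite linear0l normr0 mul0r.
have [->|y0] := eqVneq y 0; first by rewrite linear0r normr0 mulr0.
have xy0 : 0 < `|x| * `|y| by rewrite mulr_gt0 ?normr_gt0.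
(* The two scaled vectors have equal norm, so this square expands to
   [2 * |x| * |y| * (|x| * |y| - inner x y)]. *)
have : 0 <= inner (`|y| *: x - `|x| *: y) (`|y| *: x - `|x| *: y).
  by rewrite inner_norm sqr_ge0.
rewrite linearBl/= !linearBr/= !linearZl_LR/= !linearZr_LR/= !inner_norm.
rewrite (innerC y x) /GRing.scale/= -(ler_pM2l xy0).
by move: (inner x y) (`|x|) (`|y|) => i a b; lra.
Qed.

Lemma normr_inner_le x y : `|inner x y| <= `|x| * `|y|.
Proof.
rewrite ler_norml inner_le andbT lerNl -(normrN x).
by rewrite -linearNl inner_le.
Qed.

Lemma inner_continuous z : continuous (fun y : Y => inner z y).
Proof.
apply: (@bounded_linear_continuous _ _ _ (inner z : {linear Y -> R^o})).
apply/bounded_funP => r; exists (`|z| * r) => y yr.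
by rewrite (le_trans (normr_inner_le _ _))// ler_wpM2l.
Qed.

Lemma cvg_inner z (s : nat -> Y) l : s @ \oo --> l ->
  (fun k => inner z (s k)) @ \oo --> inner z l.
Proof. by move=> sl; apply: continuous_cvg => //; exact: inner_continuous. Qed.

End Inner.

(** * Extraction of subsequences *)

Lemma increasing_cvgny (f : nat -> nat) : increasing_seq f -> f @ \oo --> \oo.
Proof.
move=> fi; apply/cvgnyPge => n; near=> k.
apply: (@leq_trans k); last exact: (unstable.mono_leq_infl fi).
by near: k; exact: nbhs_infty_ge.
Unshelve. all: by end_near. Qed.

Lemma increasing_seq_comp (f g : nat -> nat) :
  increasing_seq f -> increasing_seq g -> increasing_seq (f \o g).
Proof. by move=> fi gi m n; exact: etrans (fi _ _) (gi _ _). Qed.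

Lemma finite_range_cst_increasing (T : Type) (u : nat -> T) :
  finite_set (range u) ->
  exists2 f : nat -> nat, increasing_seq f & exists c, forall k, u (f k) = c.
Proof.
move=> /finite_range_cst_subsequence[c [A Aoo Ac]].
have [|f [fi _ fA]] := infinite_increasing_seq_wf _ Aoo 0%N.
  by move=> n; apply: sub_finite_set (finite_II n.+1) => m /=.
by exists f => //; exists c => k; apply/Ac.
Qed.

Section BolzanoWeierstrass.
Context {R : realType} {Y : fdHilbertType R}.

(** Induction on [zs]: each new vector costs one extraction from a bounded real sequence, and the
    limits already obtained survive it. *)
Let bw_inner (zs : seq Y) (s : nat -> Y) (M : R) : (forall k, `|s k| <= M) ->
  exists2 f : nat -> nat, increasing_seq f &
    forall z, z \in zs -> cvgn (fun k => inner z (s (f k))).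
Proof.
move=> sM; elim: zs => [|z zs [f fi IH]]; first by exists id.
have [|g gi gz] := @bolzano_weierstrass R (fun k => inner z (s (f k))).
  exists (`|z| * M); split; first exact: num_real.
  move=> r /ltW Mr k _ /=; apply: le_trans Mr.
  by rewrite (le_trans (normr_inner_le _ _))// ler_wpM2l.
exists (f \o g); first exact: increasing_seq_comp.
move=> z'; rewrite inE => /predU1P[->//|/IH zc].
apply/cvg_ex; eexists.
exact: (cvg_comp g (fun k => inner z' (s (f k))) (increasing_cvgny gi) zc).
Qed.

Lemma bounded_cvg_subseq (s : nat -> Y) (M : R) : (forall k, `|s k| <= M) ->
  exists2 f : nat -> nat, increasing_seq f & exists l : Y, s \o f @ \oo --> l.
Proof.
move=> sM; pose b := vbasis {:Y}.
(* By Riesz the coordinates are inner products with finitely many vectors, so one subsequence makes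
   all of them converge. *)
have /choice[r rE] : forall i, exists z, forall u : Y, inner z u = coord b i u.
  by move=> i; exact: (riesz (coord b i : {linear Y -> R})).
have [f fi fc] := @bw_inner [seq r i | i <- enum 'I_(\dim {:Y})] s M sM.
exists f => //.
exists (\sum_i limn (fun k => inner (r i) (s (f k))) *: b`_i).
rewrite (_ : s \o f = \sum_i (fun k => inner (r i) (s (f k)) *: b`_i)).
  elim/big_ind2 : _ => [|u lu v lv ul vl|i _]; first exact: cvg_cst.
    exact: cvgD.
  by apply: cvgZ; [apply: fc; apply: map_f; rewrite mem_enum|exact: cvg_cst].
apply/funext => k /=; rewrite fct_sumE.
rewrite [LHS](coord_vbasis (memvf (s (f k)))).
by apply: eq_bigr => i _; rewrite rE.
Qed.

End BolzanoWeierstrass.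

(** * Regular normals to polyhedra and to their finite unions *)

Section PolyhedralNormals.
Context {R : realType} {Y : fdHilbertType R}.
Implicit Types (Omega Q Lambda : set Y) (y d zeta : Y).

(** Along the ray [y + tau *: d] the quotient in the limsup is constantly [inner zeta d / |d|]. *)
Lemma regular_normal_feasible Omega y zeta d :
  regular_normal_cone Omega y zeta ->
  (\forall tau \near (0 : R)^'+, Omega (y + tau *: d)) -> inner zeta d <= 0.
Proof.
have [->|d0] := eqVneq d 0; first by rewrite linear0r.
move=> [_ zN] yd; have nd : 0 < `|d| by rewrite normr_gt0.
have tdy : (fun tau : R => y + tau *: d) tau @[tau --> 0^'+] --> y.
  rewrite -[X in _ --> X]addr0 -(scale0r d).
  apply: cvgD; first exact: cvg_cst.
  apply: cvgZ; last exact: cvg_cst.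
  exact: cvg_at_right_filter.
suff : ((inner zeta d / `|d|)%:E <= 0)%E.
  by rewrite lee_fin pmulr_lle0// invr_gt0.
(* The limsup is an infimum of suprema over the sets [V] of the filter; each [V] contains a point of
   the ray other than [y]. *)
apply: le_trans zN; apply: le_ereal_inf_tmp => _ [V /= VN <-].
have : \forall tau \near (0 : R)^'+, V (y + tau *: d) /\ 0 < tau.
  near=> tau.
  have tau0 : 0 < tau by near: tau; exact: nbhs_right_gt.
  split=> //.
  have : Omega (y + tau *: d) by near: tau.
  have : y + tau *: d != y.
    by rewrite -subr_eq0 addrAC subrr add0r scaler_eq0 negb_or d0 gt_eqF.
  near: tau.
  exact: (tdy _ VN).
move=> /filter_ex[tau [Vtau tau0]]; apply: ereal_sup_ubound.
exists (y + tau *: d) => //=; congr EFin.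
rewrite addrAC subrr add0r linearZr_LR/= normrZ gtr0_norm//.
by field; rewrite !gt_eqF.
Unshelve. all: by end_near. Qed.

Lemma convex_polyhedral_closed Q : convex_polyhedral Q -> closed Q.
Proof.
move=> [q [lam [b ->]]].
rewrite (_ : mkset _ = \bigcap_j [set y | inner (lam j) y <= b j]); last first.
  by apply/seteqP; split=> y yb j; [move=> _; exact: yb|exact: yb].
apply: closed_bigI => j _.
apply: (@preimage_closed _ _ (fun y => inner (lam j) y) [set r | r <= b j]).
  by move=> y _; exact: inner_continuous.
exact: closed_le.
Qed.

Lemma convex_polyhedral_normal_seq Q (s zetak : nat -> Y) y zeta :
  convex_polyhedral Q -> Q y ->
  (forall k, regular_normal_cone Q (s k) (zetak k)) ->
  zetak @ \oo --> zeta ->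
  exists2 f : nat -> nat, increasing_seq f &
    forall k, 0 <= inner zeta (s (f k) - y).
Proof.
move=> [q [lam [b ->]]] yQ zN zetacv.
pose active k := [set j | inner (lam j) (s k) == b j]%SET.
have [|f fi [J fJ]] := @finite_range_cst_increasing _ active.
  exact: finite_finset.
exists f => // k.
(* [y - s (f k)] is a feasible direction at every [s (f m)], because
   [s (f k)] and [s (f m)] have the same active constraints. *)
suff H m : inner (zetak (f m)) (y - s (f k)) <= 0.
  rewrite -opprB linearNr/= oppr_ge0 innerC.
  have cv : (fun m => inner (y - s (f k)) (zetak (f m))) @ \oo
      --> inner (y - s (f k)) zeta.
    apply: cvg_inner; apply: cvg_comp zetacv; exact: increasing_cvgny.
  apply: (@closed_cvg _ _ _ _ _ (fun r : R => r <= 0) _ _ _ cv).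
    exact: closed_le.
  by apply: nearW => m; rewrite innerC.
apply: (regular_normal_feasible (zN (f m))).
have smb := (zN (f m)).1; have skb := (zN (f k)).1.
have step j : \forall tau \near (0 : R)^'+,
    inner (lam j) (s (f m) + tau *: (y - s (f k))) <= b j.
  have cv0 :
      tau * inner (lam j) (y - s (f k)) @[tau --> (0 : R)^'+] --> (0 : R).
    rewrite -[X in _ --> X](mul0r (inner (lam j) (y - s (f k)))).
    by apply: cvgM; [exact: cvg_at_right_filter|exact: cvg_cst].
  (* An active constraint is tight at [s (f k)] too and holds at [y], so it does not increase along
     the direction; an inactive one has slack that absorbs small [tau]. *)
  have [jJ|jJ] := boolP (j \in J).
    near=> tau; have tau0 : 0 < tau by near: tau; exact: nbhs_right_gt.
    rewrite linearDr/= linearZr_LR/=.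
    have := jJ; rewrite -(fJ k) inE => /eqP jk.
    have := jJ; rewrite -(fJ m) inE => /eqP ->.
    by rewrite gerDl pmulr_rle0// linearBr/= jk subr_le0; exact: yQ.
  have jm : 0 < b j - inner (lam j) (s (f m)).
    by rewrite subr_gt0 lt_neqAle smb andbT; move: jJ; rewrite -(fJ m) inE.
  near=> tau; rewrite linearDr/= linearZr_LR/= -lerBrDl.
  apply: le_trans (ler_norm _) _.
  by near: tau; apply: cvgr0_norm_le; [exact: cv0|exact: jm].
near=> tau => /= j; move: j.
by near: tau; exact: filter_forall.
Unshelve. all: by end_near. Qed.

(** Restricting to a smaller set refines the filter, which can only lower the limsup. *)
Lemma regular_normal_cone_sub Omega Q y zeta :
  Q `<=` Omega -> Q y ->
  regular_normal_cone Omega y zeta -> regular_normal_cone Q y zeta.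
Proof.
move=> QO Qy [_ zN]; split=> //; apply: le_trans zN.
apply: ereal_inf_le_tmp => _ [V VN <-]; exists V => //.
rewrite /= /within /= in VN *.
by apply: (@filterS _ (y^') _ _ _ _ VN) => x Vx /QO.
Qed.

(** One polyhedral piece contains infinitely many [s k]. It is closed, so it contains [y], and
    normals to the union are normals to the piece. *)
Lemma polyhedral_normal_seq Lambda (s zetak : nat -> Y) y zeta :
  finite_union_of_polyhedral Lambda ->
  (forall k, regular_normal_cone Lambda (s k) (zetak k)) ->
  s @ \oo --> y -> zetak @ \oo --> zeta ->
  exists2 f : nat -> nat, increasing_seq f &
    forall k, 0 <= inner zeta (s (f k) - y).
Proof.
move=> [p [Q [Qpoly LE]]] zN scv zetacv.
have /choice[c cQ] : forall k, exists i, Q i (s k).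
  by move=> k; have := (zN k).1; rewrite {1}LE => -[i _ Qi]; exists i.
have [|f fi [i fc]] := @finite_range_cst_increasing _ c.
  exact: finite_finset.
have fcv := increasing_cvgny fi.
have fQ k : Q i (s (f k)) by rewrite -(fc k).
have Qy : Q i y.
  apply: (closed_cvg (Q i) (convex_polyhedral_closed (Qpoly i)) _ _
    (cvg_comp _ _ fcv scv)).
  exact: nearW.
have [||g gi gP] := @convex_polyhedral_normal_seq (Q i) (s \o f) (zetak \o f)
  y zeta (Qpoly i) Qy.
- move=> k; apply: regular_normal_cone_sub (fQ k) (zN (f k)).
  by rewrite LE => x Qx; exists i.
- exact: cvg_comp fcv zetacv.
by exists (f \o g) => //; exact: increasing_seq_comp.
Qed.

End PolyhedralNormals.

(** * Taylor remainder of [P] and boundedness of the second-order quotients *)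

Section Remainder.
Context {R : realType} {X Y : fdHilbertType R}.

Lemma le_opnorm (A : {linear X -> Y}) v : continuous A ->
  `|A v| <= opnorm A * `|v|.
Proof.
move=> /linear_bounded_continuous/bounded_funP/(_ 1)[M AM].
have [->|v0] := eqVneq v 0; first by rewrite linear0 !normr0 mulr0.
have nv : 0 < `|v| by rewrite normr_gt0.
rewrite -ler_pdivrMr//.
(* Continuity makes the set of values bounded, so that [sup] is a true supremum and not its default
   value. *)
apply: sup_upper_bound.
  split; first by exists `|A 0|; exists 0 => //=; rewrite normr0.
  by exists M => _ [x x1 <-]; exact: AM.
exists (`|v|^-1 *: v) => /=.
  by rewrite normrZ normfV normr_id mulVf ?gt_eqF.
by rewrite linearZ/= normrZ normfV normr_id mulrC.
Qed.

Variables (P : X -> Y) (x : X).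
Hypothesis diffP : forall x, differentiable P x.

Let is_derive_line (w : Y) (v : X) (s : R) :
  is_derive s 1 (fun s : R => inner w (P (x + s *: v) - s *: 'd P x v) : R)
    (inner w (('d P (x + s *: v) \- 'd P x) v)).
Proof.
have dl : is_diff s ((fun=> x) + ( *:%R^~ v)) (0 + ( *:%R^~ v)).
  by apply: is_diffD; exact: is_diff_cst.
have dP : is_diff (((fun=> x) + ( *:%R^~ v)) s) P ('d P (x + s *: v)).
  exact: differentiableP.
have dB := is_diffB (is_diff_comp dl dP) (is_diff_scalel s ('d P x v)).
have dw y : is_diff y (inner w : Y -> R) (inner w).
  have cw : continuous (inner w : {linear Y -> R^o}) by exact: inner_continuous.
  by apply: DiffDef; [exact: linear_differentiable|exact: diff_lin].
have dphi := is_diff_comp dB (dw _).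
have dd := @ex_diff _ _ _ _ _ _ _ dphi.
apply: DeriveDef; first exact: diff_derivable.
rewrite deriveE//.
rewrite (@diff_val _ _ _ _ _ _ _ dphi).
by rewrite /= !fctE/= scale1r add0r scale1r.
Qed.

(** The mean value theorem needs a real-valued function, so [P] is paired with the remainder [w]
    itself: the increment of [phi] is then [|w| ^+ 2], and one factor [|w|] cancels. *)
Lemma first_order_remainder_le (v : X) (K : R) :
  (forall c, 0 < c < 1 -> opnorm ('d P (x + c *: v) \- 'd P x) <= K) ->
  `|P (x + v) - P x - 'd P x v| <= K * `|v|.
Proof.
move=> opK; set w := _ - _.
pose phi s : R := inner w (P (x + s *: v) - s *: 'd P x v).
have [c c01] : exists2 c : R, c \in `]0, 1[%R & phi 1 - phi 0 =
    inner w (('d P (x + c *: v) \- 'd P x) v) * (1 - 0).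
  apply: (MVT (df := fun c => inner w (('d P (x + c *: v) \- 'd P x) v))) => //.
    by move=> s _; exact: is_derive_line.
  apply: continuous_subspaceT => s.
  apply: differentiable_continuous; apply/derivable1_diffP.
  exact: (@ex_derive _ _ _ _ _ _ _ (is_derive_line w v s)).
rewrite /phi !scale1r !scale0r addr0 !subr0 mulr1 -linearBr/=.
rewrite (_ : _ - _ - _ = w); last by rewrite addrAC.
rewrite inner_norm => wE.
have dK : `|('d P (x + c *: v) \- 'd P x) v| <= K * `|v|.
  apply: le_trans (le_opnorm _ _) _.
    by move=> z; apply: continuousB; exact: diff_continuous.
  by rewrite ler_wpM2r// opK//; move: c01; rewrite in_itv.
have [->|w0] := eqVneq w 0; first by rewrite normr0 (le_trans _ dK).
have nw : 0 < `|w| by rewrite normr_gt0.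
by rewrite -(ler_pM2l nw) -expr2 wE (le_trans (inner_le _ _))// ler_pM2l.
Qed.

End Remainder.

Lemma calm_quotient_bounded (R : realType) (X Y : fdHilbertType R) (P : X -> Y)
    (x u : X) (t : R^nat) (uk : nat -> X) :
  (forall x, differentiable P x) -> directionally_calm_gradient P x u ->
  positive_null t -> uk @ \oo --> u ->
  exists M : R, \forall k \near \oo,
    `|(2^-1 * t k ^+ 2)^-1 *:
       (P (x + t k *: uk k) - P x - t k *: 'd P x (uk k))| <= M.
Proof.
move=> diffP [e [d [L [e0 d0 L0 calm]]]] [t0 tcv] ucv.
(* Calmness bounds the remainder by [L * |t k *: uk k| ^+ 2]; dividing by [t k ^+ 2 / 2] gives the
   factor 2, and eventually [|uk k| <= |u| + d]. *)
exists (2 * L * (`|u| + d) ^+ 2).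
near=> k.
have te : t k < e by near: k; exact: (cvgr_lt _ tcv).
have ud : `|uk k - u| < d.
  by rewrite distrC; near: k; apply: cvgr_dist_lt; [exact: ucv|exact: d0].
have uM : `|uk k| <= `|u| + d.
  by rewrite -(subrK u (uk k)) addrC (le_trans (ler_normD _ _))// lerD2l ltW.
have tk0 := t0 k.
have : `|P (x + t k *: uk k) - P x - 'd P x (t k *: uk k)| <=
    L * `|t k *: uk k| * `|t k *: uk k|.
  apply: first_order_remainder_le => // c /andP[c0 c1].
  (* Intermediate points of the segment keep the direction [uk k] with the shorter step [c * t k],
     so calmness applies to them. *)
  rewrite scalerA; apply: le_trans (calm (c * t k) (uk k) _ _ ud) _.
  - exact: mulr_gt0.
  - by apply: le_lt_trans te; rewrite ler_piMl ?ltW.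
  - rewrite ler_pM2l// -scalerA normrZ gtr0_norm//.
    by rewrite ler_piMl// ltW.
rewrite linearZ/= => rle; rewrite normrZ gtr0_norm; last first.
  by rewrite invr_gt0 mulr_gt0// exprn_gt0.
rewrite ler_pdivrMl; last by rewrite mulr_gt0// exprn_gt0.
apply: le_trans rle _; rewrite normrZ gtr0_norm//.
rewrite (_ : L * _ * _ = L * t k ^+ 2 * `|uk k| ^+ 2); last by ring.
rewrite [leRHS](_ : _ = L * t k ^+ 2 * (`|u| + d) ^+ 2); last by field.
by rewrite ler_pM2l ?mulr_gt0 ?exprn_gt0// ler_sqr// nnegrE ?(le_trans _ uM).
Unshelve. all: by end_near. Qed.

Theorem theorem4p1 (R : realType) (X Y : fdHilbertType R) (P : X -> Y)
    (Lambda : set Y) (xbar : X) :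
  continuously_differentiable P ->
  finite_union_of_polyhedral Lambda ->
  Lambda (P xbar) ->
  (forall u, critical_direction P Lambda xbar u ->
     directionally_calm_gradient P xbar u) ->
  SOSCMS P Lambda xbar ->
  directional_pseudo_normality P Lambda xbar.
Proof.
move=> [diffP _] Lpoly _ calm soscms u ucrit.
move=> [zeta [zeta0 adj0 zetaN [uk [sk [zetak [t [ucv scv zcv tnull H]]]]]]].
have [t0 tcv] := tnull.
apply: (soscms u ucrit); exists zeta; split=> //.
pose lk k := (2^-1 * t k ^+ 2)^-1 *:
  (P (xbar + t k *: uk k) - P xbar - t k *: 'd P xbar (uk k)).
have [f fi fs] := polyhedral_normal_seq Lpoly (fun k => (H k).1) scv zcv.
have lk_ge0 k : 0 <= inner zeta (lk (f k)).
  rewrite linearZr_LR/=; apply: mulr_ge0.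
    by rewrite invr_ge0 mulr_ge0// sqr_ge0.
  (* The adjoint condition removes the gradient term; the remaining increment of [P] is split at
     [sk (f k)]. *)
  rewrite linearBr/= linearZr_LR/= -adjointP adj0 linear0l mulr0 subr0.
  rewrite -[P _ - _](subrKA (sk (f k))) linearDr/=.
  by rewrite addr_ge0// ltW// (H (f k)).2.
have [M [N _ lM]] := calm_quotient_bounded diffP (calm u ucrit) tnull ucv.
(* The quotients are bounded only from rank [N] on; the shift suffices because [f n >= n]. *)
pose f' k := f (N + k)%N.
have f'i : increasing_seq f'.
  by move=> m n; rewrite /f' fi; exact: leq_add2l.
have [|g gi [l lcv]] := @bounded_cvg_subseq _ _ (lk \o f') M.
  move=> k; apply: lM => /=.
  exact: leq_trans (leq_addr _ _) (unstable.mono_leq_infl fi _).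
have hcv := increasing_cvgny (increasing_seq_comp f'i gi).
exists l; split; last first.
  apply: (closed_cvg (fun r : R => 0 <= r) _ _ _ (cvg_inner (z := zeta) lcv)).
    exact: closed_ge.
  by apply: nearW => k; exact: lk_ge0.
exists (t \o (f' \o g)), (uk \o (f' \o g)); split => //.
- by split; [move=> k; exact: t0|exact: cvg_comp hcv tcv].
- exact: cvg_comp hcv ucv.
Qed.
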